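(* For the complement $M$ of the figure-eight knot, $X_0$ has exactly two ideal points, $[1:0:0]$ and $[0:0:1]$.
   Context: $M$ is the complement in $S^3$ of the figure-eight knot, with $$\pi_1(M)=\langle\alpha,\beta\mid\beta^{-1}\alpha^{-1}\beta\alpha\beta^{-1}\alpha\beta\alpha^{-1}\beta^{-1}\alpha\rangle,$$ where $\alpha,\beta$ are meridians. The $SL_2(\mathbb{C})$-character variety $X(M)$ is identified with a plane curve via $\chi\mapsto(x,z)=(\chi(\alpha),\chi(\alpha\beta))$ (note $\chi(\alpha)=\chi(\beta)$). $X_0$ is the irreducible component of $X(M)$ containing the characters of the discrete faithful representations of the complete hyperbolic structure; it is the affine curve $z^2-(1+x^2)z+2x^2-1=0$ in $\mathbb{C}^2$. Identify $\mathbb{C}^2$ with the open subset $\{[x:1:z]\}$ of $\mathbb{CP}^2$ (homogeneous coordinates $[X:Y:Z]$). The smooth projective model of $X_0$ is the curve $\widetilde{X_0}=\{YZ^2-Y^2Z-X^2Z+2X^2Y-Y^3=0\}\subset\mathbb{CP}^2$. An ideal point of $X_0$ is a point of $\widetilde{X_0}$ not lying in $X_0$. *)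

(* Defs.v *)
From HB Require Import structures.
From mathcomp Require Import all_boot all_order all_algebra.
From mathcomp Require Import all_classical reals.
From mathcomp Require Import complex.
From mathcomp Require Import mpoly.

Set Implicit Arguments.
Unset Strict Implicit.
Unset Printing Implicit Defensive.

Import Order.TTheory GRing.Theory Num.Theory.

Local Open Scope classical_set_scope.
Local Open Scope ring_scope.
Local Open Scope complex_scope.

(* The letter (i, false) stands for the generator i, (i, true) for its
   inverse. *)
Definition word (I : choiceType) := seq (I * bool).

Definition inv_letter (I : choiceType) (l : I * bool) : I * bool :=
  (l.1, ~~ l.2).

Definition inv_word (I : choiceType) (w : word I) : word I :=
  rev (map (@inv_letter I) w).

Section Presentation.
Variables (I : choiceType) (rels : set (word I)).

(* Two words are related exactly when they represent the same element of
   the free group modulo the normal closure of rels. *)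
Inductive word_eq : word I -> word I -> Prop :=
| WordRefl u : word_eq u u
| WordSym u v : word_eq u v -> word_eq v u
| WordTrans u v w : word_eq u v -> word_eq v w -> word_eq u w
| WordCancel u v l : word_eq (u ++ [:: l; inv_letter l] ++ v) (u ++ v)
| WordRel u v r : rels r -> word_eq (u ++ r ++ v) (u ++ v).

Definition word_eqb : rel (word I) := fun u v => `[< word_eq u v >].

Fact word_eqb_refl : reflexive word_eqb.
Proof. by move=> u; apply/asboolP; apply: WordRefl. Qed.

Fact word_eqb_sym : ssrbool.symmetric word_eqb.
Proof. by move=> u v; apply/asboolP/asboolP; apply: WordSym. Qed.

Fact word_eqb_trans : transitive word_eqb.
Proof.
by move=> v u w /asboolP uv /asboolP vw; apply/asboolP; apply: WordTrans uv vw.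
Qed.

Definition word_equiv := EquivRel word_eqb word_eqb_refl word_eqb_sym
  word_eqb_trans.

Definition presented := {eq_quot word_equiv}%qT.

HB.instance Definition _ := Choice.on presented.

Definition class_of (w : word I) : presented := (\pi_presented w)%qT.

Lemma class_ofP u v : class_of u = class_of v <-> word_eq u v.
Proof.
split=> [/eqP|uv].
  by rewrite /class_of eqmodE => /asboolP.
by apply/eqP; rewrite /class_of eqmodE; apply/asboolP.
Qed.

Lemma class_repr (g : presented) : class_of (repr g) = g.
Proof. exact: reprK. Qed.

Lemma word_eq_cat u u' v v' :
  word_eq u u' -> word_eq v v' -> word_eq (u ++ v) (u' ++ v').
Proof.
move=> uu' vv'; apply: (@WordTrans _ (u' ++ v)).
  elim: uu' => {u u'} [u|u w _ IH|u w x _ IH1 _ IH2|u w l|u w r rr].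
  - exact: WordRefl.
  - exact: WordSym.
  - exact: WordTrans IH1 IH2.
  - by rewrite -!catA; apply: (WordCancel u (w ++ v) l).
  - by rewrite -!catA; apply: (WordRel u (w ++ v) rr).
elim: vv' => {v v'} [v|v w _ IH|v w x _ IH1 _ IH2|v w l|v w r rr].
- exact: WordRefl.
- exact: WordSym.
- exact: WordTrans IH1 IH2.
- by have := WordCancel (u' ++ v) w l; rewrite -!catA.
- by have := WordRel (u' ++ v) w rr; rewrite -!catA.
Qed.

Lemma inv_letterK : involutive (@inv_letter I).
Proof. by case=> i b; rewrite /inv_letter negbK. Qed.

Lemma inv_wordK : involutive (@inv_word I).
Proof.
move=> w; rewrite /inv_word map_rev revK -map_comp -[RHS]map_id.
by apply: eq_map => l /=; rewrite inv_letterK.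
Qed.

Lemma word_eq_mulV w : word_eq (w ++ inv_word w) [::].
Proof.
elim/last_ind: w => [|w l IH]; first exact: WordRefl.
rewrite /inv_word map_rcons rev_rcons -/(inv_word w) cat_rcons.
exact: WordTrans (WordCancel w (inv_word w) l) IH.
Qed.

Lemma word_eq_Vmul w : word_eq (inv_word w ++ w) [::].
Proof. by have := word_eq_mulV (inv_word w); rewrite inv_wordK. Qed.

Lemma word_eq_inv u v : word_eq u v -> word_eq (inv_word u) (inv_word v).
Proof.
move=> uv.
have e1 : word_eq (inv_word u) (inv_word u ++ (v ++ inv_word v)).
  rewrite -[X in word_eq X _]cats0.
  by apply: word_eq_cat; [exact: WordRefl | apply/WordSym/word_eq_mulV].
apply: WordTrans e1 _; rewrite catA -[X in word_eq _ X]cat0s.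
apply: word_eq_cat; last exact: WordRefl.
apply: WordTrans (word_eq_Vmul u).
by apply: word_eq_cat; [exact: WordRefl | exact: WordSym].
Qed.

Definition presented_one : presented := class_of [::].
Definition presented_mul (g h : presented) : presented :=
  class_of (repr g ++ repr h).
Definition presented_inv (g : presented) : presented :=
  class_of (inv_word (repr g)).

Lemma class_of_cat u v :
  class_of (u ++ v) = presented_mul (class_of u) (class_of v).
Proof.
by apply/class_ofP; apply: word_eq_cat; apply/class_ofP; rewrite class_repr.
Qed.

Lemma class_of_inv u : class_of (inv_word u) = presented_inv (class_of u).
Proof. by apply/class_ofP/word_eq_inv/class_ofP; rewrite class_repr. Qed.

Fact presented_mulA : associative presented_mul.
Proof.
move=> g h k; rewrite -(class_repr g) -(class_repr h) -(class_repr k).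
by rewrite -!class_of_cat catA.
Qed.

Fact presented_mul1g : left_id presented_one presented_mul.
Proof. by move=> g; rewrite -(class_repr g) -class_of_cat. Qed.

Fact presented_mulg1 : right_id presented_one presented_mul.
Proof. by move=> g; rewrite -(class_repr g) -class_of_cat cats0. Qed.

Fact presented_mulVg : left_inverse presented_one presented_inv presented_mul.
Proof.
move=> g; rewrite -(class_repr g) -class_of_inv -class_of_cat.
exact/class_ofP/word_eq_Vmul.
Qed.

Fact presented_mulgV : right_inverse presented_one presented_inv presented_mul.
Proof.
move=> g; rewrite -(class_repr g) -class_of_inv -class_of_cat.
exact/class_ofP/word_eq_mulV.
Qed.

HB.instance Definition _ := isGroup.Build presented
  presented_mulA presented_mul1g presented_mulg1
  presented_mulVg presented_mulgV.

Definition gen (i : I) : presented := class_of [:: (i, false)].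

End Presentation.

(* The generator false is alpha, the generator true is beta. *)
Definition fig8_relator : word bool :=
  let a := (false, false) in let A := inv_letter a in
  let b := (true, false) in let B := inv_letter b in
  [:: B; A; b; a; B; a; b; A; B; a].

Definition fig8_group : groupType := presented [set fig8_relator].

Definition fig8_alpha : fig8_group := gen [set fig8_relator] false.
Definition fig8_beta : fig8_group := gen [set fig8_relator] true.

Section Affine.
Variables (F : fieldType) (n : nat).

Definition zero_locus (S : set {mpoly F[n]}) : set 'rV[F]_n :=
  [set v | forall p, S p -> p.@[v 0] = 0].

Definition zariski_closed (V : set 'rV[F]_n) : Prop :=
  exists S : set {mpoly F[n]}, V = zero_locus S.

Definition zariski_irreducible (V : set 'rV[F]_n) : Prop :=
  V !=set0 /\
  forall A B : set 'rV[F]_n, zariski_closed A -> zariski_closed B ->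
    V `<=` A `|` B -> V `<=` A \/ V `<=` B.

Definition irreducible_component (X V : set 'rV[F]_n) : Prop :=
  [/\ V `<=` X, zariski_irreducible V
    & forall W, W `<=` X -> zariski_irreducible W -> V `<=` W -> W = V].

End Affine.

Section Projective.
Variable F : fieldType.

(* Points of the projective plane are the lines of F^3. *)
Definition projective_plane : set {vspace 'rV[F]_3} :=
  [set L | \dim L = 1%N].

(* [X : Y : Z]; a point of the plane only if (X, Y, Z) is nonzero. *)
Definition pt (X Y Z : F) : {vspace 'rV[F]_3} :=
  <[\row_(i < 3) [:: X; Y; Z]`_i]>%VS.

Definition proj_zero_locus (p : {mpoly F[3]}) : set {vspace 'rV[F]_3} :=
  [set L | projective_plane L /\ forall v, v \in L -> p.@[v 0] = 0].

(* The affine plane sits in the projective plane as the points [x : 1 : z]. *)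
Definition affine_chart (v : 'rV[F]_2) : {vspace 'rV[F]_3} :=
  pt (v 0 0) 1 (v 0 1).

Definition smooth_plane_curve (p : {mpoly F[3]}) : Prop :=
  forall L, proj_zero_locus p L ->
  forall v, v \in L -> v != 0 -> exists i, (mderiv i p).@[v 0] != 0.

(* V is a smooth projective plane curve (over an algebraically closed field it
   is then irreducible) in which V0 is a nonempty, hence dense, open subset. *)
Definition smooth_projective_model (V0 : set 'rV[F]_2)
    (V : set {vspace 'rV[F]_3}) : Prop :=
  V0 !=set0 /\
  exists (d : nat) (p : {mpoly F[3]}),
    [/\ p \is d.-homog, smooth_plane_curve p, V = proj_zero_locus p
      & V `&` range affine_chart = affine_chart @` V0].

End Projective.

Section Characters.
Variable R : realType.
Local Notation C := R[i].

Section Representations.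
Variable G : groupType.
Implicit Type rho : G -> 'M[C]_2.

Definition SL2_rep rho : Prop :=
  (forall g, \det (rho g) = 1) /\
  (forall g h, rho (g * h)%g = rho g *m rho h).

Definition discrete_rep rho : Prop :=
  exists2 e : R, 0 < e &
    forall g, (forall i j, `|rho g i j - 1%:M i j| < e%:C) -> rho g = 1%:M.

Definition discrete_faithful rho : Prop :=
  [/\ SL2_rep rho, injective rho & discrete_rep rho].

Definition char_of rho (g : G) : C := \tr (rho g).

End Representations.

(* The coordinates (x, z) = (chi(alpha), chi(alpha beta)) determine the
   character, since alpha and beta are conjugate. *)
Definition char_point (rho : fig8_group -> 'M[C]_2) : 'rV[C]_2 :=
  \row_(i < 2) [:: char_of rho fig8_alpha;
                   char_of rho (fig8_alpha * fig8_beta)%g]`_i.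

Definition fig8_char_variety : set 'rV[C]_2 :=
  [set char_point rho | rho in [set rho | SL2_rep rho]].

(* The manifold group is torsion-free with a rank-two abelian cusp subgroup, so
   by Mostow-Prasad rigidity its discrete faithful representations are, up to
   conjugation in SL_2(C) and complex conjugation, precisely
   the lifts of the holonomy of the complete hyperbolic structure. *)
Definition is_canonical_component (X0 : set 'rV[C]_2) : Prop :=
  irreducible_component fig8_char_variety X0 /\
  exists2 rho : fig8_group -> 'M[C]_2, discrete_faithful rho & X0 (char_point rho).

Definition fig8_cubic : {mpoly C[3]} :=
  let X : {mpoly C[3]} := 'X_0 in
  let Y : {mpoly C[3]} := 'X_1 in
  let Z : {mpoly C[3]} := 'X_2 in
  Y * Z ^+ 2 - Y ^+ 2 * Z - X ^+ 2 * Z + 2%:R * X ^+ 2 * Y - Y ^+ 3.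

Definition fig8_model : set {vspace 'rV[C]_3} := proj_zero_locus fig8_cubic.

Definition ideal_points (X0 : set 'rV[C]_2) (V : set {vspace 'rV[C]_3}) :
  set {vspace 'rV[C]_3} := V `\` (@affine_chart C @` X0).

End Characters.

Arguments fig8_model R : clear implicits.

(* Main.v *)
Require Import Defs.
From HB Require Import structures.
From mathcomp Require Import all_boot all_order all_algebra.
From mathcomp Require Import all_classical reals.
From mathcomp Require Import complex.
From mathcomp Require Import mpoly.
From mathcomp Require Import ring.

(** Put [x = tr A], [z = tr (A B)] for the images [A], [B] of the two
    meridians under an SL_2(C)-representation of the figure-eight group, and
    [w = b a^-1 b^-1 a], with image [W].  The relation says that [a w = w b];
    hence [tr A = tr B], and the Cayley-Hamilton theorem gives
      [A W - W B = phi(x, z) (A - B)],  [phi = z^2 - (1 + x^2) z + 2 x^2 - 1]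
    ([fig8_poly_mx]).  So either [phi(x, z) = 0], or [A = B] and
    [z = x^2 - 2]: the character variety lies in the union of the curve
    [phi = 0] and of the parabola of abelian characters.  Conversely the same
    identity turns any pair [A], [B] whose traces satisfy [phi = 0] into a
    representation, so that the whole curve [phi = 0] consists of characters.

    An irreducible component lies in one of the two closed curves.  A component
    with a faithful character does not lie in the parabola: there
    [tr [A, B] = 2], the commutator [K = [A, B]] commutes with its conjugate
    [A K A^-1] ([comm_unipotent]), while the corresponding elements of the group
    do not commute, as an action on five points shows ([fig8_not_metabelian]).
    So it lies in [phi = 0], and it is all of it as that curve is irreducible
    ([fig8_curve_irreducible]): its coordinate ring is free over C[x] with basis
    1, z, and the norm to C[x] of a nonzero element is nonzero because
    [(x^2 - 1) (x^2 - 5)], the discriminant of [phi] in [z], is not a square.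

    The projective part is a computation with the cubic form: its partial
    derivatives have no common zero, it restricts to [phi] on the chart [Y = 1],
    and to [- X^2 Z] on the line [Y = 0], which leaves the two points at
    infinity. *)

Set Implicit Arguments.
Unset Strict Implicit.
Unset Printing Implicit Defensive.

Import Order.TTheory GRing.Theory Num.Theory.

Local Open Scope classical_set_scope.
Local Open Scope ring_scope.

(** * A word whose class witnesses that the group is not metabelian *)

Section Action.
Variables (I : choiceType) (rels : set (word I)) (T : Type).
Variable act : I * bool -> T -> T.
Hypothesis actK : forall l x, act l (act (inv_letter l) x) = x.
Hypothesis act_rel : forall r x, rels r -> foldr act x r = x.

(** Letters acting on [T] so that inverse letters act inversely and relators act
    trivially define an action of the presented group. *)
Lemma word_eq_act u v : word_eq rels u v -> foldr act ^~ u =1 foldr act ^~ v.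
Proof.
elim=> {u v} [u|u v _ IH|u v w _ IH1 _ IH2|u v l|u v r rr] x //.
- by rewrite IH1.
- by rewrite !foldr_cat /= actK.
- by rewrite !foldr_cat (act_rel _ rr).
Qed.

End Action.

(** The commutator [k = a b a^-1 b^-1]. *)
Definition commutator_word : word bool :=
  let a := (false, false) in let A := inv_letter a in
  let b := (true, false) in let B := inv_letter b in
  [:: a; b; A; B].

(** The commutator of [k] and [a k a^-1], an element of the second derived
    subgroup. *)
Definition derived2_word : word bool :=
  let a := (false, false) in let A := inv_letter a in
  let k := commutator_word in let k' := a :: k ++ [:: A] in
  k ++ k' ++ inv_word k ++ inv_word k'.

(** The group acts on five points, [a] as (0 1)(2 3 4) and [b] as
    (0 1 2)(3 4), and the word moves the point 0. *)
Lemma fig8_not_metabelian :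
  ~ word_eq [set fig8_relator] derived2_word [::].
Proof.
(* The list of the images of 0, ..., 4; other integers are fixed. *)
pose perm_of (l : bool * bool) : seq nat :=
  match l with
  | (false, false) => [:: 1; 0; 3; 4; 2]
  | (false, true) => [:: 1; 0; 4; 2; 3]
  | (true, false) => [:: 1; 2; 0; 4; 3]
  | (true, true) => [:: 2; 0; 1; 4; 3]
  end%N.
pose act l x := if (x < 5)%N then nth 0%N (perm_of l) x else x.
move/(word_eq_act (act := act)) => H.
have {}H x : foldr act x derived2_word = x.
  apply: H => [[[] []] [|[|[|[|[|y]]]]] //|r y ->].
  by case: y => [|[|[|[|[|y]]]]].
by have := H 0%N.
Qed.

(** * Trace identities for two-by-two matrices *)

Section SL2.
Variable F : comNzRingType.

(** The matrix with rows [a, b] and [c, d]. *)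
Definition mx2 (a b c d : F) : 'M[F]_2 :=
  \matrix_(i, j) if i == 0 then (if j == 0 then a else b)
                 else (if j == 0 then c else d).

Lemma mx2P (P : 'M[F]_2 -> Prop) : (forall a b c d, P (mx2 a b c d)) ->
  forall A, P A.
Proof.
move=> H A.
suff -> : A = mx2 (A 0 0) (A 0 1) (A 1 0) (A 1 1) by [].
by apply/matrixP=> -[[|[|//]] hi] [[|[|//]] hj]; rewrite !mxE /=;
   congr (A _ _); apply: val_inj.
Qed.

Lemma mx2_eq a b c d a' b' c' d' : a = a' -> b = b' -> c = c' -> d = d' ->
  mx2 a b c d = mx2 a' b' c' d'.
Proof. by move=> -> -> -> ->. Qed.

Lemma mul_mx2 a b c d a' b' c' d' : mx2 a b c d *m mx2 a' b' c' d' =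
  mx2 (a * a' + b * c') (a * b' + b * d') (c * a' + d * c') (c * b' + d * d').
Proof.
by apply/matrixP=> -[[|[|//]] hi] [[|[|//]] hj];
  rewrite !mxE !big_ord_recl big_ord0 !mxE /= addr0.
Qed.

Lemma add_mx2 a b c d a' b' c' d' : mx2 a b c d + mx2 a' b' c' d' =
  mx2 (a + a') (b + b') (c + c') (d + d').
Proof.
by apply/matrixP=> -[[|[|//]] hi] [[|[|//]] hj]; rewrite !mxE.
Qed.

Lemma opp_mx2 a b c d : - mx2 a b c d = mx2 (- a) (- b) (- c) (- d).
Proof.
by apply/matrixP=> -[[|[|//]] hi] [[|[|//]] hj]; rewrite !mxE.
Qed.

Lemma scale_mx2 k a b c d : k *: mx2 a b c d = mx2 (k * a) (k * b) (k * c) (k * d).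
Proof.
by apply/matrixP=> -[[|[|//]] hi] [[|[|//]] hj]; rewrite !mxE.
Qed.

Lemma scalar_mx2 k : k%:M = mx2 k 0 0 k.
Proof.
by apply/matrixP=> -[[|[|//]] hi] [[|[|//]] hj]; rewrite !mxE.
Qed.

Lemma tr_mx2 a b c d : \tr (mx2 a b c d) = a + d.
Proof. by rewrite /mxtrace !big_ord_recl big_ord0 !mxE /= addr0. Qed.

Lemma det_mx2 a b c d : \det (mx2 a b c d) = a * d - b * c.
Proof.
rewrite (expand_det_row _ 0) !big_ord_recl big_ord0 /cofactor !det_mx11 !mxE /=.
by rewrite expr0 expr1; ring.
Qed.

Lemma adj_mx2 a b c d : \adj (mx2 a b c d) = mx2 d (- b) (- c) a.
Proof.
apply/matrixP=> -[[|[|//]] hi] [[|[|//]] hj];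
  by rewrite !mxE /cofactor det_mx11 !mxE /= ?expr0 ?expr1 ?mul1r ?mulN1r //=
    -signr_odd /= expr0 mul1r.
Qed.

Definition mx2E := (mul_mx2, opp_mx2, add_mx2, scale_mx2, scalar_mx2,
  adj_mx2, det_mx2, tr_mx2).

(** The polynomial [phi] whose zero set is the canonical component. *)
Definition fig8_poly (x z : F) := z ^+ 2 - (1 + x ^+ 2) * z + 2 * x ^+ 2 - 1.

(** As [A W = W B] is the relation of the figure-eight group, it holds exactly
    when [phi] vanishes or [A = B]. *)
Lemma fig8_poly_mx (A B : 'M[F]_2) (W := B *m \adj A *m \adj B *m A) :
  \det A = 1 -> \det B = 1 -> \tr A = \tr B ->
  A *m W - W *m B = fig8_poly (\tr A) (\tr (A *m B)) *: (A - B).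
Proof.
rewrite /W {W}; elim/mx2P: A => a b c d; elim/mx2P: B => p q r s.
rewrite !mx2E /fig8_poly => detA detB trAB.
have bc : b * c = a * d - 1 by rewrite -detA; ring.
have -> : s = a + d - p by rewrite trAB; ring.
have qr : q * r = p * (a + d - p) - 1 by rewrite -detB trAB; ring.
by apply: mx2_eq; ring: bc qr.
Qed.

(** The traces of [K = [A, B]] and of [K A]; when [z = x^2 - 2] they are 2 and
    [x]. *)
Lemma tr_commutator (A B : 'M[F]_2)
    (K := A *m B *m \adj A *m \adj B) (x := \tr A) (z := \tr (A *m B)) :
  \det A = 1 -> \det B = 1 -> \tr A = \tr B ->
  \tr K = z ^+ 2 - x ^+ 2 * z + 2 * x ^+ 2 - 2 /\
  \tr (K *m A) = x * (z ^+ 2 - z - (x ^+ 2 - 1) * z + 2 * x ^+ 2 - 3).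
Proof.
rewrite /K /x /z {K x z}; elim/mx2P: A => a b c d; elim/mx2P: B => p q r s.
rewrite !mx2E => detA detB trAB.
have bc : b * c = a * d - 1 by rewrite -detA; ring.
have -> : s = a + d - p by rewrite trAB; ring.
have qr : q * r = p * (a + d - p) - 1 by rewrite -detB trAB; ring.
by split; ring: bc qr.
Qed.

Implicit Types A B K M N : 'M[F]_2.

Lemma mul_mx_adj1 A : \det A = 1 -> A *m \adj A = 1%:M.
Proof. by move=> dA; rewrite mul_mx_adj dA. Qed.

Lemma mul_adj_mx1 A : \det A = 1 -> \adj A *m A = 1%:M.
Proof. by move=> dA; rewrite mul_adj_mx dA. Qed.

Lemma adj_mul2 A B : \adj (A *m B) = \adj B *m \adj A.
Proof.
elim/mx2P: A => a b c d; elim/mx2P: B => p q r s.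
by rewrite !mx2E; apply: mx2_eq; ring.
Qed.

Lemma adj2K A : \adj (\adj A) = A.
Proof. by elim/mx2P: A => a b c d; rewrite !mx2E !opprK. Qed.

Lemma det_adj2 A : \det (\adj A) = \det A.
Proof. by elim/mx2P: A => a b c d; rewrite !mx2E; ring. Qed.

(** The Cayley-Hamilton identity for [N A], with a factor [A] cancelled. *)
Lemma mulmx_sandwich2 N A :
  N *m A *m N = \tr (N *m A) *: N - \det N *: \adj A.
Proof.
elim/mx2P: A => a b c d; elim/mx2P: N => p q r s.
by rewrite !mx2E; apply: mx2_eq; ring.
Qed.

Lemma tr_sqr2 A : \det A = 1 -> \tr (A *m A) = \tr A ^+ 2 - 2.
Proof.
elim/mx2P: A => a b c d; rewrite !mx2E => dA.
transitivity ((a + d) ^+ 2 - 2 * (a * d - b * c)); first by ring.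
by rewrite dA mulr1.
Qed.

Lemma det_sub1 K : \det K = 1 -> \det (K - 1%:M) = 2 - \tr K.
Proof.
elim/mx2P: K => a b c d; rewrite !mx2E => dK.
transitivity (a * d - b * c + 1 - (a + d)); first by ring.
by rewrite dK; ring.
Qed.

(** The hypotheses make [N = K - 1] singular with [tr N = tr (N A) = 0], so that
    [N N = N A N = 0] by [mulmx_sandwich2]; then [N] and [A N A^-1] have both
    products zero. *)
Lemma comm_unipotent A K : \det A = 1 -> \det K = 1 -> \tr K = 2 ->
  \tr (K *m A) = \tr A -> comm_mx K (A *m K *m \adj A).
Proof.
move=> dA dK tK tKA.
pose N := K - 1%:M.
have dN : \det N = 0 by rewrite det_sub1 // tK subrr.
have NAN : N *m A *m N = 0.
  by rewrite mulmx_sandwich2 dN scale0r subr0 mulmxBl mul1mx mxtraceD linearN /=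
     tKA subrr scale0r.
have NN : N *m N = 0.
  rewrite -{1}[N]mulmx1 mulmx_sandwich2 dN mulmx1 scale0r subr0 mxtraceD linearN /=.
  by rewrite tK mxtrace1 subrr scale0r.
have KN : K = N + 1%:M by rewrite subrK.
clearbody N.
have adjE : \adj A = (\tr A)%:M - A.
  elim/mx2P: (A) => a b c d.
  by rewrite !mx2E; apply: mx2_eq; ring.
have NAaN : N *m (A *m N *m \adj A) = 0 by rewrite !mulmxA NAN mul0mx.
have NaAN : A *m N *m \adj A *m N = 0.
  rewrite -!mulmxA adjE mulmxBl mul_scalar_mx mulmxBr.
  by rewrite -scalemxAr NN mulmxA NAN scaler0 subrr mulmx0.
rewrite KN.
have -> : A *m (N + 1%:M) *m \adj A = A *m N *m \adj A + 1%:M.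
  by rewrite mulmxDr mulmx1 mulmxDl mul_mx_adj1.
rewrite /comm_mx !mulmxDr !mulmxDl !mulmx1 !mul1mx NAaN NaAN.
by rewrite !add0r addrCA.
Qed.

(** The matrix of a letter; the adjugate stands for the inverse, which it is in
    determinant 1. *)
Definition letter_mx A B (l : bool * bool) : 'M[F]_2 :=
  let M := if l.1 then B else A in if l.2 then \adj M else M.

(** The value of a word at a pair of matrices. *)
Definition word_mx A B (w : word bool) : 'M[F]_2 :=
  foldr (fun l M => letter_mx A B l *m M) 1%:M w.

Lemma word_mx_cat A B u v :
  word_mx A B (u ++ v) = word_mx A B u *m word_mx A B v.
Proof. by elim: u => [|l u IH] /=; rewrite ?mul1mx // IH mulmxA. Qed.

Lemma det_letter_mx A B l : \det A = 1 -> \det B = 1 ->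
  \det (letter_mx A B l) = 1.
Proof. by case: l => [[] []] dA dB; rewrite /letter_mx /= ?det_adj2. Qed.

Lemma det_word_mx A B w : \det A = 1 -> \det B = 1 -> \det (word_mx A B w) = 1.
Proof.
move=> dA dB; elim: w => [|l w IH] /=; first exact: det1.
by rewrite det_mulmx IH det_letter_mx ?mulr1.
Qed.

Lemma letter_mx_inv A B l : letter_mx A B (inv_letter l) = \adj (letter_mx A B l).
Proof. by case: l => [[] []]; rewrite /letter_mx /= ?adj2K. Qed.

Lemma word_mx_inv A B w : word_mx A B (inv_word w) = \adj (word_mx A B w).
Proof.
elim: w => [|l w IH].
  by rewrite /word_mx /= !mx2E oppr0.
rewrite /inv_word map_cons rev_cons -cats1 word_mx_cat -/(inv_word w) IH /= mulmx1.
by rewrite letter_mx_inv -adj_mul2.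
Qed.

Section Pair.
Variables A B : 'M[F]_2.
Hypotheses (dA : \det A = 1) (dB : \det B = 1).
Let W := B *m \adj A *m \adj B *m A.

Lemma fig8_relator_mx :
  word_mx A B fig8_relator = 1%:M <-> A *m W = W *m B.
Proof.
have dW : \det W = 1 by rewrite /W !det_mulmx !det_adj2 dA dB !mulr1.
have -> : word_mx A B fig8_relator = \adj B *m (\adj W *m (A *m W)).
  by rewrite /word_mx /= /letter_mx /= /W !adj_mul2 !adj2K mulmx1 !mulmxA.
split=> [H|->].
  have : W *m (B *m (\adj B *m (\adj W *m (A *m W)))) = W *m B.
    by rewrite H mulmx1.
  by rewrite !mulmxA -(mulmxA W) mul_mx_adj1 // mulmx1 mul_mx_adj1 // mul1mx.
by rewrite (mulmxA (\adj W)) mul_adj_mx1 // mul1mx mul_adj_mx1.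
Qed.

Lemma fig8_relator_tr : word_mx A B fig8_relator = 1%:M -> \tr A = \tr B.
Proof.
have dW : \det W = 1 by rewrite /W !det_mulmx !det_adj2 dA dB !mulr1.
move/fig8_relator_mx => H.
rewrite -[A]mulmx1 -(mul_mx_adj1 dW) mulmxA H mxtrace_mulC mulmxA.
by rewrite mul_adj_mx1 // mul1mx.
Qed.

(** By [comm_unipotent], applied to the commutator of [A] and [B]. *)
Lemma derived2_word_mx : \tr A = \tr B -> \tr (A *m B) = (\tr A) ^+ 2 - 2 ->
  word_mx A B derived2_word = 1%:M.
Proof.
move=> tAB z.
have [tK tKA] := tr_commutator dA dB tAB; rewrite z in tK tKA.
set K := A *m B *m \adj A *m \adj B in tK tKA.
have EK : word_mx A B commutator_word = K.
  by rewrite /word_mx /= /letter_mx /= /K mulmx1 !mulmxA.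
pose k' : word bool := (false, false) :: commutator_word ++ [:: (false, true)].
have EK' : word_mx A B k' = A *m K *m \adj A.
  rewrite -[k']/([:: (false, false)] ++ commutator_word ++ [:: (false, true)]).
  by rewrite !word_mx_cat EK /word_mx /= /letter_mx /= !mulmx1 mulmxA.
have dK : \det K = 1 by rewrite -EK det_word_mx.
have dK' : \det (A *m K *m \adj A) = 1 by rewrite -EK' det_word_mx.
have cK : comm_mx K (A *m K *m \adj A).
  by apply: comm_unipotent => //; rewrite ?tK ?tKA; ring.
rewrite -[derived2_word]/(commutator_word ++ k' ++
  inv_word commutator_word ++ inv_word k').
rewrite !word_mx_cat !word_mx_inv EK EK' mulmxA -adj_mul2 -cK.
by rewrite mul_mx_adj1 // det_mulmx dK dK' mulr1.
Qed.

End Pair.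

End SL2.

(** * The affine curve and its irreducibility *)

Section Curve.
Variable F : numClosedFieldType.

(** The curve [phi(x, z) = 0]. *)
Definition fig8_curve : set 'rV[F]_2 := [set v | fig8_poly (v 0 0) (v 0 1) = 0].

(** The parabola [z = x^2 - 2] of the characters of the abelian
    representations. *)
Definition abelian_curve : set 'rV[F]_2 := [set v | v 0 1 = v 0 0 ^+ 2 - 2].

(** The point [(x, z)] of the affine plane. *)
Definition plane_point (x z : F) : 'rV[F]_2 := \row_(i < 2) [:: x; z]`_i.

Lemma plane_point_x x z : plane_point x z 0 0 = x. Proof. by rewrite mxE. Qed.
Lemma plane_point_z x z : plane_point x z 0 1 = z. Proof. by rewrite mxE. Qed.

Lemma plane_pointE (v : 'rV[F]_2) : v = plane_point (v 0 0) (v 0 1).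
Proof.
by apply/rowP=> -[[|[|//]] hi]; rewrite mxE /=; congr (v _ _); apply: val_inj.
Qed.

Lemma zariski_closed_zeros n (p : {mpoly F[n]}) :
  zariski_closed [set v : 'rV[F]_n | p.@[v 0] = 0].
Proof.
exists [set p]; apply/seteqP; split=> v /=; first by move=> pv q ->.
exact.
Qed.

Lemma fig8_curve_closed : zariski_closed fig8_curve.
Proof.
have := zariski_closed_zeros (fig8_poly ('X_0 : {mpoly F[2]}) 'X_1).
congr (zariski_closed _); apply/funext => v /=.
rewrite /fig8_curve /fig8_poly /= !(rmorph_nat, mevalB, mevalD, mevalM, rmorphXn, meval1) /=.
by rewrite !mevalXU.
Qed.

Lemma abelian_curve_closed : zariski_closed abelian_curve.
Proof.
have := zariski_closed_zeros ('X_1 - ('X_0 ^+ 2 - 2) : {mpoly F[2]}).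
congr (zariski_closed _); apply/funext => v /=.
rewrite /abelian_curve /= !(rmorph_nat, mevalB, mevalD, mevalM, rmorphXn, meval1) /=.
rewrite !mevalXU; apply/propext.
by split=> [/eqP|->]; rewrite ?subrr // subr_eq0 => /eqP.
Qed.

(** For fixed [x], [phi] splits as a monic quadratic polynomial in [z]. *)
Lemma fig8_poly_root (x : F) : exists s : F,
  forall z, fig8_poly x z = (z - (1 + x ^+ 2 + s) / 2) * (z - (1 + x ^+ 2 - s) / 2).
Proof.
exists (sqrtC ((1 + x ^+ 2) ^+ 2 - 4 * (2 * x ^+ 2 - 1))) => z.
set s := sqrtC _.
have ss : s ^+ 2 = (1 + x ^+ 2) ^+ 2 - 4 * (2 * x ^+ 2 - 1) by exact: sqrtCK.
rewrite /fig8_poly.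
have -> : (z - (1 + x ^+ 2 + s) / 2) * (z - (1 + x ^+ 2 - s) / 2) =
   z ^+ 2 - (1 + x ^+ 2) * z + ((1 + x ^+ 2) ^+ 2 - s ^+ 2) / 4 by field.
by rewrite ss; field.
Qed.

Lemma SL2_pair_exists (x z : F) : exists A B : 'M[F]_2,
  [/\ \det A = 1, \det B = 1, \tr A = x, \tr B = x & \tr (A *m B) = z].
Proof.
(* A root of [q^2 - z q + 1]. *)
pose q := (z + sqrtC (z ^+ 2 - 4)) / 2.
have q_eq : q * (z - q) = 1.
  have : sqrtC (z ^+ 2 - 4) ^+ 2 = z ^+ 2 - 4 by exact: sqrtCK.
  rewrite /q; move: (sqrtC _) => s ss.
  transitivity ((z ^+ 2 - s ^+ 2) / 4); first by field.
  by rewrite ss; field.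
exists (mx2 x (-1) 1 0), (mx2 0 q (q - z) x).
by rewrite !mx2E; split; [ring|rewrite -q_eq; ring|ring|ring|ring].
Qed.

(** Division by [phi]: the coordinate ring is spanned by 1 and [z] over the
    polynomials in [x]. *)
Lemma fig8_curve_repr (p : {mpoly F[2]}) : exists p0 p1 : {poly F},
  forall v, fig8_curve v -> p.@[v 0] = p0.[v 0 0] + p1.[v 0 0] * v 0 1.
Proof.
have zpow n : exists a b : {poly F}, forall v, fig8_curve v ->
    v 0 1 ^+ n = a.[v 0 0] + b.[v 0 0] * v 0 1.
  elim: n => [|n [a [b H]]].
    by exists 1, 0 => v _; rewrite expr0 !hornerE ?mul0r ?addr0.
  (* [z (a + b z) = a z + b z^2], where [z^2 = (1 + x^2) z + (1 - 2 x^2)]. *)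
  exists (b * (1 - 2 *: 'X^2)), (a + b * (1 + 'X^2)) => v Ev.
  rewrite exprS H // !hornerE /=.
  apply/eqP; rewrite -subr_eq0; apply/eqP.
  transitivity (b.[v 0 0] * fig8_poly (v 0 0) (v 0 1)); last by rewrite Ev mulr0.
  rewrite /fig8_poly. ring.
elim/mpolyind: p => [|c m p _ _ [p0 [p1 H]]].
  by exists 0, 0 => v _; rewrite meval0 !hornerE ?mul0r ?addr0.
have [a [b Hab]] := zpow (m 1).
exists (c *: 'X^(m 0) * a + p0), (c *: 'X^(m 0) * b + p1) => v Ev.
rewrite mevalD mevalZ mevalX H // !big_ord_recl big_ord0 mulr1.
have -> : lift ord0 ord0 = 1 :> 'I_2 by apply: val_inj.
by rewrite Hab // !hornerE /=; ring.
Qed.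

(** The discriminant [(X^2 - 1) (X^2 - 5)] is not a square of a rational
    function, since 1 is a simple root of it. *)
Lemma fig8_discr_nonsquare (u p : {poly F}) :
  u ^+ 2 = p ^+ 2 * (('X ^+ 2 - 1) * ('X ^+ 2 - 5%:P)) -> p = 0.
Proof.
set D := ('X^2 - 1) * _ => H; apply/eqP/negPn/negP => p0.
have : p %| u by rewrite -(@dvdp_pexp2r _ _ _ 2) // H dvdp_mulIl.
case/dvdpP => k Ek.
have kD : k ^+ 2 = D.
  apply: (mulfI (expf_neq0 2 p0)). by rewrite -H Ek exprMn mulrC.
have k1 : k.[1] = 0.
  apply/eqP; suff : k.[1] ^+ 2 == 0 by rewrite expf_eq0.
  by rewrite -horner_exp kD /D !hornerE /= ?expr1n subrr mul0r.
have := congr1 (fun q => (q^`()).[1]) kD.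
rewrite expr2 derivM !hornerE k1 /D !(derivE, hornerE) /= !expr1n => /eqP.
have -> : (1 + 1 - 0) * (1 - 5) + (1 - 1) * (1 + 1 - 0) = - 8%:R :> F by ring.
by rewrite eq_sym oppr_eq0 pnatr_eq0.
Qed.

(** A regular function not vanishing on the whole curve has a nonzero norm [N] to
    the polynomials in [x], and [N] vanishes wherever the function does. *)
Lemma fig8_curve_norm (p : {mpoly F[2]}) :
  (exists2 v, fig8_curve v & p.@[v 0] != 0) ->
  exists2 N : {poly F}, N != 0 &
    forall v, fig8_curve v -> p.@[v 0] = 0 -> N.[v 0 0] = 0.
Proof.
case=> w Ew pw; have [p0 [p1 H]] := fig8_curve_repr p.
(* The product of [p0 + p1 z] and its conjugate [p0 + p1 (1 + x^2 - z)]. *)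
exists (p0 ^+ 2 + p0 * p1 * (1 + 'X^2) + p1 ^+ 2 * (2 *: 'X^2 - 1)).
  apply/eqP => N0.
  have p10 : p1 = 0.
    apply: (@fig8_discr_nonsquare (2 * p0 + p1 * (1 + 'X^2))).
    apply/eqP; rewrite -subr_eq0; apply/eqP.
    transitivity (4 * (p0 ^+ 2 + p0 * p1 * (1 + 'X^2) + p1 ^+ 2 * (2 *: 'X^2 - 1)));
      last by rewrite N0 mulr0.
    have -> : 5%:P = 5 :> {poly F} by rewrite polyC_natr.
    have -> : 2 *: 'X^2 = 2 * 'X^2 :> {poly F} by rewrite scaler_nat mulr_natl.
    by ring.
  have p00 : p0 = 0.
    apply/eqP; move: N0; rewrite p10 mulr0 mul0r expr0n /= mul0r !addr0.
    by move/eqP; rewrite expf_eq0.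
  by move: pw; rewrite H // p10 p00 !hornerE /= ?mul0r eqxx.
move=> v Ev; rewrite H // => pv; rewrite !hornerE /=.
transitivity ((p0.[v 0 0] + p1.[v 0 0] * v 0 1) *
  (p0.[v 0 0] + p1.[v 0 0] * (1 + v 0 0 ^+ 2 - v 0 1)) +
  p1.[v 0 0] ^+ 2 * fig8_poly (v 0 0) (v 0 1)); first by rewrite /fig8_poly; ring.
by rewrite pv Ev mulr0 mul0r addr0.
Qed.

Lemma poly_nonroot (p : {poly F}) : p != 0 -> exists x, p.[x] != 0.
Proof.
move=> p0; apply: contrapT => H.
pose rs : seq F := [seq i%:R | i <- iota 0 (size p)].
have rr : all (root p) rs.
  apply/allP => x _; apply/negPn/negP => nx; apply: H; exists x.
  by rewrite -rootE.
have urs : uniq rs.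
  rewrite map_inj_uniq ?iota_uniq // => i j /eqP.
  by rewrite eqr_nat => /eqP.
by have := max_poly_roots p0 rr urs; rewrite size_map size_iota ltnn.
Qed.

Lemma fig8_curve_nonempty : fig8_curve !=set0.
Proof.
exists (plane_point 1 1).
by rewrite /fig8_curve /= plane_point_x plane_point_z /fig8_poly; ring.
Qed.

(** If regular functions [p] and [q] do not vanish identically on the curve, choose
    [x] that is not a root of the product of their norms: neither [p] nor [q]
    vanishes at a point of the curve above [x]. *)
Lemma fig8_curve_irreducible : zariski_irreducible fig8_curve.
Proof.
split=> [|_ _ [S ->] [T ->] ST]; first exact: fig8_curve_nonempty.
have witness (U : set {mpoly F[2]}) : ~ (fig8_curve `<=` zero_locus U) ->
    exists2 p, U p & exists2 v, fig8_curve v & p.@[v 0] != 0.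
  move/existsNP => [v /not_implyP[Ev /existsNP[p /not_implyP[Up /eqP pv]]]].
  by exists p => //; exists v.
apply: contrapT => /not_orP[/witness[p Sp /fig8_curve_norm[N N0 HN]]].
move=> /witness[q Tq /fig8_curve_norm[M M0 HM]].
have [x] := poly_nonroot (mulf_neq0 N0 M0).
rewrite hornerM mulf_eq0 negb_or => /andP[Nx Mx].
have [s Es] := fig8_poly_root x.
pose v := plane_point x ((1 + x ^+ 2 + s) / 2).
have Ev : fig8_curve v.
  by rewrite /fig8_curve /= plane_point_x plane_point_z Es subrr mul0r.
case: (ST v Ev) => /= [/(_ p Sp)/(HN v Ev)|/(_ q Tq)/(HM v Ev)];
  rewrite plane_point_x => /eqP; first exact/negP.
exact/negP.
Qed.

End Curve.

(** * The canonical component *)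

Section CharacterVariety.
Variable R : realType.
Local Notation C := R[i].
Implicit Type rho : fig8_group -> 'M[C]_2.

Lemma SL2_rep1 (G : groupType) (rho : G -> 'M[C]_2) :
  SL2_rep rho -> rho 1%g = 1%:M.
Proof.
move=> [dr mr]; have := mr 1%g 1%g; rewrite mulg1 => H.
have /mul_mx_adj1 <- := dr 1%g; rewrite {2}H -mulmxA.
by rewrite mul_mx_adj1 ?mulmx1.
Qed.

Lemma SL2_repV (G : groupType) (rho : G -> 'M[C]_2) g :
  SL2_rep rho -> rho (g^-1)%g = \adj (rho g).
Proof.
move=> rrep; have [dr mr] := rrep.
rewrite -[RHS]mul1mx -(SL2_rep1 rrep) -(mulVg g) mr -mulmxA.
by rewrite mul_mx_adj1 ?mulmx1.
Qed.

Lemma SL2_rep_class rho w : SL2_rep rho ->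
  rho (class_of [set fig8_relator] w) =
  word_mx (rho fig8_alpha) (rho fig8_beta) w.
Proof.
move=> rrep; have [dr mr] := rrep.
elim: w => [|l w IH]; first exact: SL2_rep1 rrep.
rewrite -cat1s class_of_cat.
transitivity (rho (class_of [set fig8_relator] [:: l]) *m
              rho (class_of [set fig8_relator] w)); first exact: mr.
rewrite IH /=; congr (_ *m _).
case: l => i b; rewrite /letter_mx /=.
have -> : (if i then rho fig8_beta else rho fig8_alpha) =
  rho (gen [set fig8_relator] i) by case: i.
case: b => //; rewrite -SL2_repV //; congr rho.
exact: (class_of_inv [set fig8_relator] [:: (i, false)]).
Qed.

Lemma SL2_rep_relator rho : SL2_rep rho ->
  word_mx (rho fig8_alpha) (rho fig8_beta) fig8_relator = 1%:M.
Proof.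
move=> rrep; rewrite -SL2_rep_class // -(SL2_rep1 rrep); congr rho.
apply/class_ofP.
by have := @WordRel _ [set fig8_relator] [::] [::] fig8_relator erefl; rewrite cats0.
Qed.

Lemma SL2_rep_exists (A B : 'M[C]_2) : \det A = 1 -> \det B = 1 ->
  word_mx A B fig8_relator = 1%:M ->
  exists rho, [/\ SL2_rep rho, rho fig8_alpha = A & rho fig8_beta = B].
Proof.
move=> dA dB rel.
have inv u v : word_eq [set fig8_relator] u v -> word_mx A B u = word_mx A B v.
  move=> uv; apply: (word_eq_act _ _ uv (act := fun l M => letter_mx A B l *m M)).
    move=> l M; rewrite mulmxA letter_mx_inv mul_mx_adj1 ?mul1mx //.
    exact: det_letter_mx.
  move=> _ M ->.
  have foldrE w N : foldr (fun l M => letter_mx A B l *m M) N w = word_mx A B w *m N.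
    by elim: w => [|l w IH] /=; rewrite ?mul1mx // IH mulmxA.
  by rewrite foldrE rel mul1mx.
pose rho (g : fig8_group) := word_mx A B (repr g).
have rhoE w : rho (class_of [set fig8_relator] w) = word_mx A B w.
  by apply: inv; apply/class_ofP; rewrite class_repr.
exists rho; split.
- split=> [g|g h]; first exact: det_word_mx.
  by rewrite {2 3}/rho -word_mx_cat; apply: rhoE.
- by apply: etrans (rhoE _) _; rewrite /word_mx /= mulmx1.
- by apply: etrans (rhoE _) _; rewrite /word_mx /= mulmx1.
Qed.

Lemma char_pointE rho : SL2_rep rho -> char_point rho =
  plane_point (\tr (rho fig8_alpha)) (\tr (rho fig8_alpha *m rho fig8_beta)).
Proof. by move=> [_ mr]; rewrite /char_point /char_of mr. Qed.

Lemma fig8_char_variety_sub :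
  @fig8_char_variety R `<=` @abelian_curve C `|` @fig8_curve C.
Proof.
move=> _ [rho rrep <-]; rewrite char_pointE //.
have rel := SL2_rep_relator rrep.
have dA := rrep.1 fig8_alpha; have dB := rrep.1 fig8_beta.
move: (rho fig8_alpha) (rho fig8_beta) rel dA dB => A B rel dA dB.
have tAB := fig8_relator_tr dA dB rel.
have := fig8_poly_mx dA dB tAB.
move/(fig8_relator_mx dA dB): rel => ->; rewrite subrr => /esym/eqP.
rewrite scaler_eq0 => /orP[/eqP phi0|].
  by right; rewrite /fig8_curve /= plane_point_x plane_point_z.
rewrite subr_eq0 => /eqP AB; left.
rewrite /abelian_curve /= plane_point_x plane_point_z -AB.
exact: tr_sqr2.
Qed.

Lemma fig8_curve_sub_char_variety : @fig8_curve C `<=` @fig8_char_variety R.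
Proof.
move=> v Ev.
have [A [B [dA dB tA tB tAB]]] := SL2_pair_exists (v 0 0) (v 0 1).
have rel : word_mx A B fig8_relator = 1%:M.
  apply/(fig8_relator_mx dA dB)/eqP; rewrite -subr_eq0 fig8_poly_mx ?tA ?tB //.
  by rewrite tAB Ev scale0r.
have [rho [rrep rA rB]] := SL2_rep_exists dA dB rel.
by exists rho => //; rewrite char_pointE // rA rB tA tAB -plane_pointE.
Qed.

Lemma discrete_faithful_not_abelian rho :
  SL2_rep rho -> injective rho -> ~ @abelian_curve C (char_point rho).
Proof.
move=> rrep inj; rewrite char_pointE //.
rewrite /abelian_curve /= plane_point_x plane_point_z => zx.
have dA := rrep.1 fig8_alpha; have dB := rrep.1 fig8_beta.
have tAB := fig8_relator_tr dA dB (SL2_rep_relator rrep).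
apply: fig8_not_metabelian; apply/class_ofP/inj.
apply: etrans (SL2_rep_class _ rrep) _; apply/esym.
by apply: etrans (SL2_rep_class _ rrep) _; rewrite derived2_word_mx.
Qed.

Lemma canonical_componentE X0 : @is_canonical_component R X0 -> X0 = @fig8_curve C.
Proof.
move=> [[X0sub X0irr X0max] [rho [rrep inj _] X0rho]].
have X0E : X0 `<=` @fig8_curve C.
  have [|H|] := X0irr.2 _ _ (@abelian_curve_closed C) (@fig8_curve_closed C).
  - exact: subset_trans fig8_char_variety_sub.
  - by case: (discrete_faithful_not_abelian rrep inj); apply: H.
  - exact.
apply/esym/X0max => //; first exact: fig8_curve_sub_char_variety.
exact: fig8_curve_irreducible.
Qed.

End CharacterVariety.

(** * The projective cubic *)

(** The cubic form of the projective model, in a ring so general that the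
    coordinates may be polynomial variables. *)
Definition cubic_form (K : comNzRingType) (X Y Z : K) : K :=
  Y * Z ^+ 2 - Y ^+ 2 * Z - X ^+ 2 * Z + 2%:R * X ^+ 2 * Y - Y ^+ 3.

Section CubicForm.
Variable F : numFieldType.
Implicit Types X Y Z : F.

Lemma cubic_form_chart X Z : cubic_form X 1 Z = fig8_poly X Z.
Proof. by rewrite /cubic_form /fig8_poly; ring. Qed.

Lemma cubic_form_infinity X Z : cubic_form X 0 Z = - (X ^+ 2 * Z).
Proof. by rewrite /cubic_form; ring. Qed.

Lemma cubic_formZ k X Y Z :
  cubic_form (k * X) (k * Y) (k * Z) = k ^+ 3 * cubic_form X Y Z.
Proof. by rewrite /cubic_form; ring. Qed.

(** The hypotheses are the vanishing of the partial derivatives of the cubic form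
    with respect to [X], [Y] and [Z]. *)
Lemma cubic_form_singular X Y Z :
  - 2 * X * Z + 4 * X * Y = 0 ->
  Z ^+ 2 - 2 * Y * Z + 2 * X ^+ 2 - 3 * Y ^+ 2 = 0 ->
  2 * Y * Z - Y ^+ 2 - X ^+ 2 = 0 -> [/\ X = 0, Y = 0 & Z = 0].
Proof.
have sqr0 (t : F) n : n.+1%:R * t ^+ 2 = 0 -> t = 0.
  by move/eqP; rewrite mulf_eq0 pnatr_eq0 expf_eq0 => /eqP.
move=> FX FY FZ.
have [X0|X0] := eqVneq X 0.
  move: FY FZ; rewrite X0 => FY FZ.
  have : Y * (2 * Z - Y) = 0 by rewrite -FZ; ring.
  move/eqP; rewrite mulf_eq0 => /orP[/eqP Y0|].
    by split=> //; apply: (@sqr0 _ 0); rewrite -FY Y0; ring.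
  rewrite subr_eq0 => /eqP Y2.
  (* With [X = 0] and [Y = 2 Z], the second equation is [- 15 Z^2 = 0]. *)
  have Z0 : Z = 0.
    by apply: (@sqr0 _ 14); apply/eqP; rewrite -oppr_eq0 -FY -Y2; apply/eqP; ring.
  by rewrite -Y2 Z0 mulr0.
have Z2 : Z = 2 * Y.
  have : (2 * X) * (2 * Y - Z) = 0 by rewrite -FX; ring.
  move/eqP; rewrite !mulf_eq0 (negPf X0) pnatr_eq0 /= subr_eq0.
  by move/eqP.
(* With [Z = 2 Y], the last two equations are [2 X^2 = 3 Y^2] and
   [X^2 = 3 Y^2]. *)
case/eqP: X0; apply: (@sqr0 _ 0).
have -> : 1%:R * X ^+ 2 = 2 * X ^+ 2 - 3 * Y ^+ 2 + (3 * Y ^+ 2 - X ^+ 2) by ring.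
transitivity ((Z ^+ 2 - 2 * Y * Z + 2 * X ^+ 2 - 3 * Y ^+ 2) +
  (2 * Y * Z - Y ^+ 2 - X ^+ 2)); first by rewrite Z2; ring.
by rewrite FY FZ addr0.
Qed.

(** A vector of homogeneous coordinates. *)
Definition hrow X Y Z : 'rV[F]_3 := \row_(i < 3) [:: X; Y; Z]`_i.

Lemma hrow_eq X Y Z X' Y' Z' :
  hrow X Y Z = hrow X' Y' Z' <-> [/\ X = X', Y = Y' & Z = Z'].
Proof.
split=> [/rowP H|[-> -> ->]] //.
by split; [have := H 0|have := H 1|have := H 2]; rewrite !mxE.
Qed.

Lemma hrowP (P : 'rV[F]_3 -> Prop) :
  (forall X Y Z, P (hrow X Y Z)) -> forall v, P v.
Proof.
move=> H v; suff -> : v = hrow (v 0 0) (v 0 1) (v 0 2) by [].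
by apply/rowP=> -[[|[|[|//]]] hi]; rewrite mxE /=; congr (v _ _); apply: val_inj.
Qed.

Lemma hrow0 X Y Z : (hrow X Y Z == 0) = [&& X == 0, Y == 0 & Z == 0].
Proof.
have -> : 0 = hrow 0 0 0 by apply/rowP=> -[[|[|[|//]]] hi]; rewrite !mxE.
by apply/eqP/and3P => [/hrow_eq[-> -> ->]|[/eqP-> /eqP-> /eqP->]]; rewrite ?eqxx.
Qed.

Lemma scale_hrow k X Y Z : k *: hrow X Y Z = hrow (k * X) (k * Y) (k * Z).
Proof. by apply/rowP=> -[[|[|[|//]]] hi]; rewrite !mxE. Qed.

Lemma mem_pt X Y Z (v : 'rV[F]_3) : v \in pt X Y Z <-> exists k, v = k *: hrow X Y Z.
Proof.
split; first by move/vlineP.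
by case=> k ->; rewrite memvZ // memv_line.
Qed.

Lemma pt_projective X Y Z : projective_plane (pt X Y Z) <-> hrow X Y Z != 0.
Proof.
by rewrite /projective_plane /= dim_vline; case: (hrow _ _ _ != 0).
Qed.

Lemma projective_planeP L : @projective_plane F L ->
  exists X Y Z, hrow X Y Z != 0 /\ L = pt X Y Z.
Proof.
rewrite /projective_plane /= => L1.
have L0 : vpick L != 0 by rewrite vpick0 -dimv_eq0 L1.
have : L = <[vpick L]>%VS.
  apply/eqP; rewrite eq_sym eqEdim dim_vline L0 L1 leqnn andbT.
  by rewrite -memvE memv_pick.
move: (vpick L) L0; elim/hrowP => X Y Z v0 ->.
by exists X, Y, Z.
Qed.

Lemma ptZ k X Y Z : k != 0 -> pt (k * X) (k * Y) (k * Z) = pt X Y Z.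
Proof.
move=> k0; apply/vspaceP => v; apply/idP/idP => /mem_pt[m ->]; apply/mem_pt.
  by rewrite -scale_hrow scalerA; exists (m * k).
by exists (m / k); rewrite -(scale_hrow k) scalerA divfK.
Qed.

Lemma pt_eq X Y Z X' Y' Z' : pt X Y Z = pt X' Y' Z' ->
  exists k, [/\ X = k * X', Y = k * Y' & Z = k * Z'].
Proof.
move=> E; have : hrow X Y Z \in pt X' Y' Z' by rewrite -E memv_line.
by move/mem_pt => [k]; rewrite scale_hrow => /hrow_eq; exists k.
Qed.

(** The cubic form as a polynomial in three variables. *)
Definition cubic_mpoly : {mpoly F[3]} := cubic_form 'X_0 'X_1 'X_2.

Lemma cubic_mpoly_eval X Y Z :
  cubic_mpoly.@[hrow X Y Z 0] = cubic_form X Y Z.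
Proof.
rewrite /cubic_mpoly /cubic_form.
rewrite !(rmorph_nat, mevalB, mevalD, mevalM, rmorphXn, meval1) /=.
by rewrite !mevalXU !mxE.
Qed.

Lemma cubic_mpoly_homog : cubic_mpoly \is 3.-homog.
Proof.
have hX (i : 'I_3) : ('X_i : {mpoly F[3]}) \is 1.-homog.
  by rewrite dhomogX; apply/eqP; apply: mdeg1.
have hXn (i : 'I_3) k : ('X_i ^+ k : {mpoly F[3]}) \is k.-homog.
  by have := dhomogMn k (hX i); rewrite mul1n.
rewrite /cubic_mpoly /cubic_form.
apply: rpredB; last exact: hXn.
apply: rpredD.
  apply: rpredB; first apply: rpredB.
  - exact: (dhomogM (hX _) (hXn _ 2%N)).
  - exact: (dhomogM (hXn _ 2%N) (hX _)).
  - exact: (dhomogM (hXn _ 2%N) (hX _)).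
rewrite -mulrA mulr_natl; apply: rpredMn.
exact: (dhomogM (hXn _ 2%N) (hX _)).
Qed.

Lemma cubic_mpoly_deriv X Y Z :
  [/\ (mderiv 0 cubic_mpoly).@[hrow X Y Z 0] = - 2 * X * Z + 4 * X * Y,
    (mderiv 1 cubic_mpoly).@[hrow X Y Z 0] =
       Z ^+ 2 - 2 * Y * Z + 2 * X ^+ 2 - 3 * Y ^+ 2
  & (mderiv 2 cubic_mpoly).@[hrow X Y Z 0] = 2 * Y * Z - Y ^+ 2 - X ^+ 2].
Proof.
have dX (i j : 'I_3) : ('X_j : {mpoly F[3]})^`M(i) = (i == j)%:R.
  rewrite mderivX mnm1E eq_sym; case: eqP => [->|_]; last by rewrite scale0r.
  have -> : (U_(j) - U_(j))%MM = 0%MM by apply/mnmP=> k; rewrite mnmBE mnm0E subnn.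
  by rewrite mpolyX0 scale1r.
have dN i n : (n%:R : {mpoly F[3]})^`M(i) = 0 by rewrite -mpolyC_nat mderivC.
have d1 i : (1 : {mpoly F[3]})^`M(i) = 0 := dN i 1%N.
have e2 : (('X_2 : {mpoly F[3]}).@[hrow X Y Z 0] = Z) by rewrite mevalXU !mxE.
have e1 : (('X_1 : {mpoly F[3]}).@[hrow X Y Z 0] = Y) by rewrite mevalXU !mxE.
have e0 : (('X_0 : {mpoly F[3]}).@[hrow X Y Z 0] = X) by rewrite mevalXU !mxE.
rewrite /cubic_mpoly /cubic_form !exprS !expr0.
by split; rewrite !(mderivB, mderivD, mderivM, dN, d1, dX) /=
  !(rmorph_nat, mevalB, mevalD, mevalM, meval0, meval1, e0, e1, e2);
  ring.
Qed.

Lemma cubic_locusP X Y Z :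
  proj_zero_locus cubic_mpoly (pt X Y Z) <->
  hrow X Y Z != 0 /\ cubic_form X Y Z = 0.
Proof.
split=> [[/pt_projective v0 H]|[v0 H]].
  by split=> //; rewrite -cubic_mpoly_eval; apply: H; apply: memv_line.
split; first exact/pt_projective.
by move=> _ /mem_pt[k ->]; rewrite scale_hrow cubic_mpoly_eval cubic_formZ H mulr0.
Qed.

Lemma cubic_mpoly_smooth : smooth_plane_curve cubic_mpoly.
Proof.
move=> L _ v _ v0; apply: contrapT => /forallNP H.
have {}H i : (mderiv i cubic_mpoly).@[v 0] = 0.
  by apply/eqP/negPn/negP => /H.
move: v v0 H; elim/hrowP => X Y Z v0 H.
have [FX FY FZ] := cubic_mpoly_deriv X Y Z.
have [] := @cubic_form_singular X Y Z; rewrite -?FX -?FY -?FZ ?H // => X0 Y0 Z0.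
by move: v0; rewrite hrow0 X0 Y0 Z0 eqxx.
Qed.

End CubicForm.

Section Model.
Variable R : realType.
Local Notation C := R[i].

Lemma fig8_cubicE : fig8_cubic R = cubic_mpoly C.
Proof. by []. Qed.

Lemma fig8_modelP (X Y Z : C) :
  fig8_model R (pt X Y Z) <-> hrow X Y Z != 0 /\ cubic_form X Y Z = 0.
Proof. by rewrite /fig8_model fig8_cubicE; exact: cubic_locusP. Qed.

Lemma fig8_chart (v : 'rV[C]_2) :
  fig8_model R (affine_chart v) <-> @fig8_curve C v.
Proof.
rewrite /affine_chart fig8_modelP cubic_form_chart.
by split=> [[]|] //; split=> //; rewrite hrow0 oner_eq0 /= andbF.
Qed.

Lemma fig8_smooth_projective_model :
  smooth_projective_model (@fig8_curve C) (fig8_model R).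
Proof.
split; first exact: fig8_curve_nonempty.
exists 3%N, (cubic_mpoly C); split=> //.
- exact: cubic_mpoly_homog.
- exact: cubic_mpoly_smooth.
apply/seteqP; split=> [L [EL [v _ vL]]|_ [v Ev <-]].
  by exists v => //; apply/fig8_chart; rewrite vL.
by split; [apply/fig8_chart|exists v].
Qed.

Lemma fig8_ideal_points :
  ideal_points (@fig8_curve C) (fig8_model R) = [set pt 1 0 0; pt 0 0 1].
Proof.
have infinity (X Z : C) W : ~ (@affine_chart C @` W) (pt X 0 Z).
  move=> [v _ /pt_eq[k [_ /eqP]]]; by rewrite mulr0 oner_eq0.
apply/seteqP; split=> [L [VL nL]|_ [->|->]]; last 2 first.
- split; last exact: infinity.
  by apply/fig8_modelP; rewrite hrow0 oner_eq0 cubic_form_infinity mulr0 oppr0.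
- split; last exact: infinity.
  apply/fig8_modelP; rewrite hrow0 oner_eq0 !andbF cubic_form_infinity.
  by rewrite expr0n mul0r oppr0.
have [X [Y [Z [v0 EL]]]] := projective_planeP VL.1.
move: VL nL; rewrite {}EL => VL nL.
have [Y0|Y0] := eqVneq Y 0; last first.
  have EY : pt X Y Z = affine_chart (plane_point (X / Y) (Z / Y)).
    rewrite /affine_chart plane_point_x plane_point_z -(ptZ (X / Y) 1 (Z / Y) Y0) mulr1.
    by rewrite !(mulrCA Y) divff // !mulr1.
  case: nL; exists (plane_point (X / Y) (Z / Y)) => //.
  by apply/fig8_chart; rewrite -EY.
move/fig8_modelP: VL; rewrite Y0 cubic_form_infinity hrow0 eqxx /=.
move=> [XZ0 /eqP]; rewrite oppr_eq0 mulf_eq0 expf_eq0 /= => /orP[] /eqP E.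
  move: XZ0; rewrite E eqxx /= => Z0; right => /=.
  by rewrite -(ptZ 0 0 1 Z0) !mulr0 mulr1.
move: XZ0; rewrite E eqxx andbT => X0; left => /=.
by rewrite -(ptZ 1 0 0 X0) !mulr0 mulr1.
Qed.

End Model.

Theorem corollary4p6 (R : realType) (X0 : set 'rV[R[i]]_2) :
  is_canonical_component X0 ->
  [/\ smooth_projective_model X0 (fig8_model R),
      pt 1 0 0 <> pt 0 0 1 :> {vspace 'rV[R[i]]_3}
    & ideal_points X0 (fig8_model R) = [set pt 1 0 0; pt 0 0 1]].
Proof.
move/canonical_componentE => ->; split.
- exact: fig8_smooth_projective_model.
- by move/pt_eq => [k [/eqP]]; rewrite mulr0 oner_eq0.
- exact: fig8_ideal_points.
Qed.
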